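(* The assignment $M\mapsto M^*$, $\alpha\mapsto\alpha^*$ (described in the context) defines an additive functor $\mathcal{C}(S)\to\mathcal{C}(S^* )$, the expansion functor, and this functor is exact.
   Context: Let $K$ be a field and $S=K[x_1,\ldots,x_n]$. Fix an $n$-tuple $(i_1,\ldots,i_n)$ of positive integers, let $S^*$ be the polynomial ring over $K$ in the variables $x_{jk}$, $1\le j\le n$, $1\le k\le i_j$, and set $P_j=(x_{j1},\ldots,x_{ji_j})\subseteq S^*$. For $\mathbf{a}=(a(1),\ldots,a(n))\in\mathbb{N}^n$ put $(\mathbf{x}^{\mathbf{a}})^*=P_1^{a(1)}\cdots P_n^{a(n)}\subseteq S^*$. Polynomial rings carry the standard multigrading (by exponent vectors of monomials). $\mathcal{C}(S)$ denotes the category of finitely generated multigraded $S$-modules with multigraded (degree-preserving) $S$-module homomorphisms, and similarly $\mathcal{C}(S^* )$. Multigraded $S$-modules are understood to be $\mathbb{N}^n$-graded (and $S^*$-modules $\mathbb{N}^{i_1+\cdots+i_n}$-graded), so all shifts of multigraded free $S$-modules lie in $\mathbb{N}^n$; free modules are finitely generated. On free modules: for $F=\bigoplus_i S(-\mathbf{a}_i)$ put $F^*=\bigoplus_i(\mathbf{x}^{\mathbf{a}_i})^*$. A multigraded homomorphism $\alpha:\bigoplus_{i=1}^r S(-\mathbf{a}_i)\to\bigoplus_{j=1}^s S(-\mathbf{b}_j)$ has components $S(-\mathbf{a}_i)\to S(-\mathbf{b}_j)$, $f\mapsto \lambda_{ji}\mathbf{x}^{\mathbf{a}_i-\mathbf{b}_j}f$,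 with $\lambda_{ji}\in K$ and $\lambda_{ji}=0$ if $\mathbf{x}^{\mathbf{b}_j}\nmid\mathbf{x}^{\mathbf{a}_i}$. Define $\alpha^*:\bigoplus_i(\mathbf{x}^{\mathbf{a}_i})^*\to\bigoplus_j(\mathbf{x}^{\mathbf{b}_j})^*$ as the map with components $f\mapsto\lambda_{ji}f$ if $\mathbf{x}^{\mathbf{b}_j}\mid\mathbf{x}^{\mathbf{a}_i}$ (note that then $(\mathbf{x}^{\mathbf{a}_i})^*\subseteq(\mathbf{x}^{\mathbf{b}_j})^*$), and zero otherwise. In general: for each $M\in\mathcal{C}(S)$ choose a multigraded free presentation $F_1\xrightarrow{\varphi}F_0\to M\to0$ and set $M^*=\operatorname{Coker}\varphi^*$. For a morphism $\alpha:M\to N$ in $\mathcal{C}(S)$, with chosen presentations $F_1\xrightarrow{\varphi}F_0\to M\to0$ and $G_1\xrightarrow{\psi}G_0\to N\to0$, choose a lifting $\alpha_0:F_0\to G_0$, $\alpha_1:F_1\to G_1$ of $\alpha$ (multigraded maps making the diagram of presentations commute), and let $\alpha^*:M^*\to N^*$ be the map induced by $\alpha_0^*$ and $\alpha_1^*$. *)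

(* Defs.v *)
From HB Require Import structures.
From mathcomp Require Import all_boot all_order all_algebra.
From mathcomp Require Import boolp mpoly.

Set Implicit Arguments.
Unset Strict Implicit.
Unset Printing Implicit Defensive.

Import GRing.Theory.
Local Open Scope ring_scope.
Local Open Scope quotient_scope.

Section LmodQuotient.
Variables (R : nzRingType) (V : lmodType R).
Variables (P : {pred V}) (P_submod : submod_closed P).

Definition lq_sub (_ : submod_closed P) : {pred V} := P.
HB.instance Definition _ :=
  GRing.isSubmodClosed.Build R V (lq_sub P_submod) P_submod.
Local Notation I := (lq_sub P_submod).

Definition lmodquot := Quotient.quot I.
HB.instance Definition _ := GRing.Zmodule.on lmodquot.

Definition lq_pi (x : V) : lmodquot := \pi_(Quotient.quot I) x.

Lemma lq_piB : zmod_morphism lq_pi.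
Proof. by move=> x y; rewrite /lq_pi raddfB. Qed.
HB.instance Definition _ :=
  GRing.isZmodMorphism.Build V lmodquot lq_pi lq_piB.

Lemma lq_piD x y : lq_pi (x + y) = lq_pi x + lq_pi y.
Proof. exact: raddfD. Qed.

Lemma lq_piP x y : reflect (lq_pi x = lq_pi y) (x - y \in P).
Proof.
by rewrite -[_ \in P]/(x - y \in I) Quotient.idealrBE; exact: eqP.
Qed.

Definition lq_repr (q : lmodquot) : V := repr q.

Lemma lq_reprK : cancel lq_repr lq_pi.
Proof. by move=> q; rewrite /lq_pi /lq_repr reprK. Qed.

Definition lq_scale (c : R) (q : lmodquot) : lmodquot := lq_pi (c *: lq_repr q).

Lemma lq_scaleE c x : lq_scale c (lq_pi x) = lq_pi (c *: x).
Proof.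
apply/lq_piP; rewrite -[_ \in P]/(_ \in I) -scalerBr rpredZ //.
by apply/lq_piP; rewrite lq_reprK.
Qed.

Lemma lq_scalerA a b v : lq_scale a (lq_scale b v) = lq_scale (a * b) v.
Proof. by rewrite -(lq_reprK v) !lq_scaleE scalerA. Qed.
Lemma lq_scale1r : left_id 1 lq_scale.
Proof. by move=> v; rewrite -(lq_reprK v) lq_scaleE scale1r. Qed.
Lemma lq_scalerDr : right_distributive lq_scale +%R.
Proof.
move=> a u v; rewrite -(lq_reprK u) -(lq_reprK v) -lq_piD !lq_scaleE.
by rewrite scalerDr lq_piD.
Qed.
Lemma lq_scalerDl v : {morph lq_scale^~ v : a b / a + b}.
Proof.
by move=> a b; rewrite -(lq_reprK v) !lq_scaleE scalerDl lq_piD.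
Qed.

HB.instance Definition _ := GRing.Zmodule_isLmodule.Build R lmodquot
  lq_scalerA lq_scale1r lq_scalerDr lq_scalerDl.

Lemma lq_pi_linear : linear lq_pi.
Proof. by move=> c x y; rewrite lq_piD -lq_scaleE. Qed.

End LmodQuotient.

Section Multigraded.
Variables (K : fieldType) (n : nat).
Local Notation S := {mpoly K[n]}.

(* A module with a family of subsets indexed by N^n, the candidates for the
   homogeneous components; the grading axioms are [multigraded] below. *)
Record mgdata := MgData {
  mgcar :> lmodType S;
  mgcomp : 'X_{1..n} -> mgcar -> Prop
}.

Definition multigraded (M : mgdata) : Prop :=
  [/\ forall a, mgcomp a (0 : M) /\
        (forall x y : M, mgcomp a x -> mgcomp a y -> mgcomp a (x - y)),
      forall (c : K) (b a : 'X_{1..n}) (x : M),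
        mgcomp a x -> mgcomp (b + a)%MM ((c *: 'X_[b] : S) *: x),
      forall x : M, exists (s : seq 'X_{1..n}) (h : 'X_{1..n} -> M),
        (forall a, mgcomp a (h a)) /\ x = \sum_(a <- s) h a
    & forall (s : seq 'X_{1..n}) (h : 'X_{1..n} -> M),
        uniq s -> (forall a, mgcomp a (h a)) ->
        \sum_(a <- s) h a = 0 -> forall a, a \in s -> h a = 0].

Definition finitely_generated (M : mgdata) : Prop :=
  exists (r : nat) (g : 'I_r -> M),
    forall x : M, exists c : 'I_r -> S, x = \sum_(k < r) c k *: g k.

(* The objects of C(S). *)
Record mgmod := MgMod {
  mgmod_data :> mgdata;
  mgmod_graded : multigraded mgmod_data;
  mgmod_fg : finitely_generated mgmod_data
}.

Record mghom (M N : mgdata) := MgHom {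
  mgfun :> M -> N;
  mghom_linear : linear mgfun;
  mghom_graded : forall a x, mgcomp a x -> mgcomp a (mgfun x)
}.

HB.instance Definition _ (M N : mgdata) (f : mghom M N) :=
  GRing.isLinear.Build S M N _ (mgfun f) (mghom_linear f).

Lemma mghomP (M N : mgdata) (f g : mghom M N) : f =1 g -> f = g.
Proof.
case: f g => f lf gf [g lg gg] /= /funext e; case: _ / e lg gg => lg gg.
by congr MgHom; exact: Prop_irrelevance.
Qed.

Definition mgid (M : mgdata) : mghom M M.
Proof. by refine (@MgHom M M (fun x => x) _ _). Defined.

Definition mgcomp_hom (M N P : mgdata) (g : mghom N P) (f : mghom M N) :
  mghom M P.
Proof.
refine (@MgHom M P (fun x => g (f x)) _ _).
- by move=> c x y; rewrite !linearP.
- by move=> a x xa; do 2!apply: mghom_graded.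
Defined.

(* The sum in Hom(M, N); gradedness only needs that the components of N are
   subgroups, hence the bundled target. *)
Definition mgadd (M N : mgmod) (f g : mghom M N) : mghom M N.
Proof.
refine (@MgHom M N (fun x => f x + g x) _ _).
- by move=> c x y; rewrite !linearP scalerDr addrACA.
- move=> a x xa; have [/(_ a)[N0 NB] _ _ _] := mgmod_graded N.
  rewrite -[g x]opprK; apply: (NB); first exact: mghom_graded.
  by rewrite -sub0r; apply: NB => //; exact: mghom_graded.
Defined.

Definition exact_at (M N P : mgdata) (f : mghom M N) (g : mghom N P) : Prop :=
  forall y, g y = 0 <-> exists x, y = f x.

Definition short_exact (M N P : mgdata) (f : mghom M N) (g : mghom N P) :=
  [/\ injective f, exact_at f g & forall z, exists y, z = g y].

Section Coker.
Variables (M N : mgdata) (f : mghom M N).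

Definition mgim : {pred N} := fun y => `[< exists x, y = f x >].

Lemma mgim_submod : submod_closed mgim.
Proof.
split; first by apply/asboolP; exists 0; rewrite linear0.
move=> c _ _ /asboolP[x ->] /asboolP[y ->]; apply/asboolP.
by exists (c *: x + y); rewrite linearP.
Qed.

(* The component of degree a is the image of that of N. *)
Definition coker : mgdata :=
  @MgData (lmodquot mgim_submod) (fun a q => exists2 y, mgcomp a y & q = lq_pi mgim_submod y).

Definition coker_pi : mghom N coker.
Proof.
refine (@MgHom N coker (lq_pi mgim_submod) (@lq_pi_linear _ _ _ _) _).
by move=> a x xa; exists x.
Defined.

Lemma coker_piP (x y : N) :
  coker_pi x = coker_pi y <-> exists z, x - y = f z.
Proof.
split=> [/lq_piP /asboolP //|e]; by apply/lq_piP/asboolP.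
Qed.

Lemma coker_pi_surj (q : coker) : exists y, q = coker_pi y.
Proof. by exists (lq_repr q); rewrite /= lq_reprK. Qed.

End Coker.

Section CokerHom.
Variables (M1 M0 N1 N0 : mgdata) (f : mghom M1 M0) (g : mghom N1 N0).
Variables (u0 : mghom M0 N0) (u1 : mghom M1 N1).
Hypothesis square : forall x, u0 (f x) = g (u1 x).

Definition coker_fun (q : coker f) : coker g := coker_pi g (u0 (lq_repr q)).

Lemma coker_funE x : coker_fun (coker_pi f x) = coker_pi g (u0 x).
Proof.
apply/coker_piP.
have /coker_piP[z ez] : coker_pi f (lq_repr (coker_pi f x)) = coker_pi f x.
  by rewrite /= lq_reprK.
by exists (u1 z); rewrite -square -ez raddfB.
Qed.

Definition coker_hom : mghom (coker f) (coker g).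
Proof.
refine (@MgHom (coker f) (coker g) coker_fun _ _).
- move=> c p q; have [x ->] := coker_pi_surj p; have [y ->] := coker_pi_surj q.
  by rewrite -linearP !coker_funE !linearP.
- move=> a _ [y ya ->]; rewrite -[lq_pi _ y]/(coker_pi f y) coker_funE.
  by do 2!apply: mghom_graded.
Defined.

End CokerHom.

(* The direct sum of the S(-a_i), i < r: the degree-c part of S(-a) is the
   degree-(c - a) part of S. *)
Definition freemod (r : nat) (a : 'I_r -> 'X_{1..n}) : mgdata :=
  @MgData 'rV[S]_r
    (fun c v => forall i m, m \in msupp (v 0 i) -> (m + a i)%MM = c).

(* The scalar lambda_ji : the component S(-a_i) -> S(-b_j) of alpha maps 1 to
   lambda_ji x^(a_i - b_j). *)
Definition hom_coef (r s : nat) (a : 'I_r -> 'X_{1..n}) (b : 'I_s -> 'X_{1..n})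
    (alpha : mghom (freemod a) (freemod b)) (j : 'I_s) (i : 'I_r) : K :=
  if (b j <= a i)%MM then
    ((alpha (delta_mx 0 i : 'rV[S]_r) : 'rV[S]_s) 0 j)@_(a i - b j)%MM
  else 0.

Record presentation (M : mgmod) := Presentation {
  pres_r0 : nat;
  pres_a0 : 'I_pres_r0 -> 'X_{1..n};
  pres_r1 : nat;
  pres_a1 : 'I_pres_r1 -> 'X_{1..n};
  pres_phi : mghom (freemod pres_a1) (freemod pres_a0);
  pres_eps : mghom (freemod pres_a0) M;
  pres_exact : exact_at pres_phi pres_eps;
  pres_surj : forall x, exists v, x = pres_eps v
}.

Arguments pres_a0 [M] p i : rename.
Arguments pres_a1 [M] p i : rename.

Record lifting (M N : mgmod) (p : presentation M) (q : presentation N)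
    (alpha : mghom M N) := Lifting {
  lift0 : mghom (freemod (pres_a0 p)) (freemod (pres_a0 q));
  lift1 : mghom (freemod (pres_a1 p)) (freemod (pres_a1 q));
  lift_eps : forall v, pres_eps q (lift0 v) = alpha (pres_eps p v);
  lift_phi : forall v, lift0 (pres_phi p v) = pres_phi q (lift1 v)
}.

Lemma hom_coefE r s (a : 'I_r -> 'X_{1..n}) (b : 'I_s -> 'X_{1..n})
    (alpha : mghom (freemod a) (freemod b)) j i :
  (alpha (delta_mx 0 i : 'rV[S]_r) : 'rV[S]_s) 0 j
    = hom_coef alpha j i *: 'X_[a i - b j].
Proof.
set p := (alpha _ : 'rV_s) 0 j.
have hp m : m \in msupp p -> (m + b j)%MM = a i.
  apply: (mghom_graded alpha (x := delta_mx 0 i)) => k m' /=.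
  rewrite mxE eqxx /=; case: (k =P i) => [->|_] /=; last by rewrite msupp0.
  by rewrite msupp1 inE => /eqP ->; rewrite add0m.
rewrite /hom_coef -/p; case: ifP => [le_ba|nle]; last first.
  rewrite scale0r; apply/eqP; rewrite -msupp_eq0; apply/eqP.
  case e: (msupp p) => [//|m t]; suff: (b j <= a i)%MM by rewrite nle.
  by rewrite -(hp m) ?e ?mem_head // lem_addl.
apply/mpolyP => m; rewrite mcoeffZ mcoeffX; case: eqP => [->|ne].
  by rewrite mulr1.
rewrite mulr0; apply/eqP; rewrite mcoeff_eq0; apply/negP => /hp e.
by apply: ne; rewrite -e addmK.
Qed.

Lemma hom_freeE r s (a : 'I_r -> 'X_{1..n}) (b : 'I_s -> 'X_{1..n})
    (alpha : mghom (freemod a) (freemod b)) (v : 'rV[S]_r) j :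
  (alpha v : 'rV[S]_s) 0 j
    = \sum_i v 0 i * (hom_coef alpha j i *: 'X_[a i - b j]).
Proof.
rewrite {1}[v]row_sum_delta linear_sum summxE.
by apply: eq_bigr => i _; rewrite linearZ mxE hom_coefE.
Qed.

Lemma hom_coef_comp r s t (a : 'I_r -> 'X_{1..n}) (b : 'I_s -> 'X_{1..n})
    (c : 'I_t -> 'X_{1..n}) (beta : mghom (freemod b) (freemod c))
    (alpha : mghom (freemod a) (freemod b)) k i :
  hom_coef (mgcomp_hom beta alpha) k i
    = \sum_j hom_coef beta k j * hom_coef alpha j i.
Proof.
have coef0 s' t' (b' : 'I_s' -> 'X_{1..n}) (c' : 'I_t' -> 'X_{1..n})
    (g : mghom (freemod b') (freemod c')) l m :
    ~~ (c' l <= b' m)%MM -> hom_coef g l m = 0.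
  by rewrite /hom_coef => /negbTE ->.
rewrite {1}/hom_coef; case: ifP => [le_ca|/negbT nca]; last first.
  rewrite big1 // => j _; have [le_cb|ncb] := boolP (c k <= b j)%MM; last first.
    by rewrite (coef0 _ _ _ _ beta) ?mul0r.
  rewrite [X in _ * X]coef0 ?mulr0 //; apply: contra nca => le_ba.
  exact: lepm_trans le_cb le_ba.
rewrite /= hom_freeE raddf_sum /=; apply: eq_bigr => j _.
rewrite hom_coefE -scalerAl -scalerAr scalerA mcoeffZ -mpolyXD.
have [le_cb|ncb] := boolP (c k <= b j)%MM; last first.
  by rewrite (coef0 _ _ _ _ beta) // !(mul0r, mulr0).
have [le_ba|nba] := boolP (b j <= a i)%MM; last first.
  by rewrite [hom_coef alpha _ _]coef0 // !(mul0r, mulr0).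
have -> : (a i - b j + (b j - c k))%MM = (a i - c k)%MM.
  apply/mnmP => l; rewrite mnmDE !mnmBE.
  by move/mnm_lepP: le_cb => /(_ l) ?; move/mnm_lepP: le_ba => /(_ l) ?; rewrite addnBA // subnK.
by rewrite mcoeffX eqxx mulr1 mulrC.
Qed.

End Multigraded.

Section Ideals.
Variable R : comNzRingType.
Implicit Types (A I J : R -> Prop).

Definition ideal_gen A : R -> Prop := fun x =>
  exists (r : nat) (c g : 'I_r -> R),
    (forall k, A (g k)) /\ x = \sum_(k < r) c k * g k.

Definition ideal_full : R -> Prop := fun _ => True.

Definition idealM I J : R -> Prop :=
  ideal_gen (fun z => exists x y, [/\ I x, J y & z = x * y]).

Definition idealX I (k : nat) : R -> Prop := iter k (idealM I) ideal_full.

Definition is_ideal I := I 0 /\ forall c x y, I x -> I y -> I (c * x + y).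

Lemma ideal_gen_ideal A : is_ideal (ideal_gen A).
Proof.
split; first by exists 0%N, (fun=> 0), (fun=> 0); split=> [[]|] //; rewrite big_ord0.
move=> c _ _ [r [d [g [Ag ->]]]] [s [e [h [Ah ->]]]].
pose cat (u : 'I_r -> R) (v : 'I_s -> R) k :=
  match split k with inl k => u k | inr k => v k end.
exists (r + s)%N, (cat (fun k => c * d k) e), (cat g h); split.
  by move=> k; rewrite /cat; case: (split k).
rewrite big_split_ord mulr_sumr /cat; congr (_ + _); apply: eq_bigr => k _ /=.
  by rewrite (unsplitK (inl k)) mulrA.
by rewrite (unsplitK (inr k)).
Qed.

Lemma ideal_sum I (r : nat) (c g : 'I_r -> R) :
  is_ideal I -> (forall k, I (g k)) -> I (\sum_(k < r) c k * g k).
Proof.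
case=> I0 IP Ig; elim/big_ind: _ => //= [x y Ix Iy|k _].
  by rewrite -[x]mul1r; exact: IP.
by rewrite -[_ * _]addr0; exact: IP.
Qed.

Lemma idealMS I I' J J' : (forall x, I x -> I' x) -> (forall x, J x -> J' x) ->
  forall x, idealM I J x -> idealM I' J' x.
Proof.
move=> sI sJ _ [r [c [g [hg ->]]]]; exists r, c, g; split=> // k.
by have [x [y [/sI Ix /sJ Jy e]]] := hg k; exists x, y.
Qed.

Lemma idealM_subr I J : is_ideal J -> forall x, idealM I J x -> J x.
Proof.
move=> Jid _ [r [c [g [hg ->]]]]; apply: ideal_sum => // k.
have [x [y [_ Jy ->]]] := hg k; rewrite -[_ * _]addr0.
by case: Jid => J0 JP; exact: JP.
Qed.

Lemma idealX_ideal I k : is_ideal (idealX I k).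
Proof. by case: k => [|k] //; exact: ideal_gen_ideal. Qed.

Lemma idealX_antitone I k l : (l <= k)%N -> forall x, idealX I k x -> idealX I l x.
Proof.
move=> /subnK <-; elim: (k - l)%N => [//|d IH] x /idealM_subr Ix.
by apply: IH; apply: Ix; exact: idealX_ideal.
Qed.

End Ideals.

Section Expansion.
Variables (K : fieldType) (n : nat) (i_ : 'I_n -> nat).

(* The variable x_jk is 'X_(tagnat.Rank j k), where tagnat.Rank j k is the
   position of (j, k) among the i_1 + ... + i_n pairs. *)
Local Notation Sx := {mpoly K[\sum_(j < n) i_ j]}.

Definition expP (j : 'I_n) : Sx -> Prop :=
  ideal_gen (fun z => exists k : 'I_(i_ j), z = 'X_(tagnat.Rank j k)).

Definition expX (a : 'X_{1..n}) : Sx -> Prop :=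
  \big[@idealM Sx/@ideal_full Sx]_(j < n) idealX (expP j) (a j).

Lemma expX_ideal a : is_ideal (expX a).
Proof. by apply: big_rec => // j I _ _; exact: ideal_gen_ideal. Qed.

Lemma expX_antitone (a b : 'X_{1..n}) :
  (b <= a)%MM -> forall x, expX a x -> expX b x.
Proof.
move=> /mnm_lepP le_ba.
apply: (big_ind2 (fun I J : Sx -> Prop => forall x, I x -> J x)) => //.
- by move=> I I' J J' sI sJ; exact: idealMS.
- by move=> j _; exact: idealX_antitone.
Qed.

Section ExpFree.
Variables (r : nat) (a : 'I_r -> 'X_{1..n}).

Definition expfree_pred : {pred 'rV[Sx]_r} :=
  fun v => `[< forall i, expX (a i) (v 0 i) >].

Lemma expfree_submod : submod_closed expfree_pred.
Proof.
split; first by apply/asboolP => i; rewrite mxE; case: (expX_ideal (a i)).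
move=> c u v /asboolP hu /asboolP hv; apply/asboolP => i; rewrite !mxE.
by case: (expX_ideal (a i)) => _; apply.
Qed.
HB.instance Definition _ :=
  GRing.isSubmodClosed.Build Sx 'rV[Sx]_r expfree_pred expfree_submod.

Record expfree_car := ExpFree {
  expfree_val :> 'rV[Sx]_r;
  expfree_valP : expfree_val \in expfree_pred
}.
HB.instance Definition _ := [isSub for expfree_val].
HB.instance Definition _ := [Choice of expfree_car by <:].
HB.instance Definition _ := [SubChoice_isSubLmodule of expfree_car by <:].

(* The direct sum of the ideals (x^a_i)^*, each with the grading inherited from
   S^*. *)
Definition expfree : mgdata K (\sum_(j < n) i_ j) :=
  @MgData K _ expfree_car
    (fun c v => forall i m, m \in msupp (expfree_val v 0 i) -> m = c).

End ExpFree.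

Section ExpFreeHom.
Variables (r s : nat) (a : 'I_r -> 'X_{1..n}) (b : 'I_s -> 'X_{1..n}).
Variable alpha : mghom (freemod K a) (freemod K b).

Definition expfree_row (v : 'rV[Sx]_r) : 'rV[Sx]_s :=
  \row_j \sum_i hom_coef alpha j i *: v 0 i.

Lemma expfree_rowP (v : expfree_car a) :
  expfree_row (expfree_val v) \in expfree_pred b.
Proof.
case: v => v /= /asboolP hv; apply/asboolP => j; rewrite mxE.
have [I0 IP] := expX_ideal (b j).
have hterm i : expX (b j) (hom_coef alpha j i *: v 0 i).
  rewrite /hom_coef; case: ifP => [le_ba|_]; last by rewrite scale0r.
  by rewrite -mul_mpolyC -[_ * _]addr0; apply: IP => //; exact: expX_antitone (hv i).
elim/big_ind: _ => //= x y Ix Iy; by rewrite -[x]mul1r; exact: IP.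
Qed.

Definition expfree_hom : mghom (expfree a) (expfree b).
Proof.
refine (@MgHom _ _ (expfree a) (expfree b)
  (fun v => ExpFree (expfree_rowP v)) _ _).
- move=> c u v; apply/val_inj/rowP => j; rewrite /= !mxE mulr_sumr -big_split.
  by apply: eq_bigr => i _; rewrite /= !mxE scalerDr scalerAr.
- move=> c v hv j m /=; rewrite mxE => hm; apply: contrapT => ne.
  move: hm; rewrite mcoeff_msupp raddf_sum big1 ?eqxx // => i _ /=.
  rewrite mcoeffZ memN_msupp_eq0 ?mulr0 //; apply/negP => /hv; exact: ne.
Defined.

End ExpFreeHom.

Lemma expfree_hom_square r1 r0 s1 s0 (a1 : 'I_r1 -> 'X_{1..n})
    (a0 : 'I_r0 -> 'X_{1..n}) (b1 : 'I_s1 -> 'X_{1..n})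
    (b0 : 'I_s0 -> 'X_{1..n})
    (phi : mghom (freemod K a1) (freemod K a0))
    (psi : mghom (freemod K b1) (freemod K b0))
    (u0 : mghom (freemod K a0) (freemod K b0))
    (u1 : mghom (freemod K a1) (freemod K b1)) :
  (forall v, u0 (phi v) = psi (u1 v)) ->
  forall v, expfree_hom u0 (expfree_hom phi v)
          = expfree_hom psi (expfree_hom u1 v).
Proof.
move=> sq.
have compE p q t (a : 'I_p -> 'X_{1..n}) (b : 'I_q -> 'X_{1..n})
    (c : 'I_t -> 'X_{1..n}) (g : mghom (freemod K b) (freemod K c))
    (f : mghom (freemod K a) (freemod K b)) v :
    expfree_hom g (expfree_hom f v) = expfree_hom (mgcomp_hom g f) v.
  apply/val_inj/rowP => k; rewrite /= !mxE.
  transitivity (\sum_j \sum_i hom_coef g k j *: (hom_coef f j i *: expfree_val v 0 i)).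
    by apply: eq_bigr => j _; rewrite mxE scaler_sumr.
  rewrite exchange_big /=; apply: eq_bigr => i _.
  rewrite hom_coef_comp scaler_suml; apply: eq_bigr => j _.
  by rewrite scalerA.
move=> v; rewrite !compE; congr (mgfun (expfree_hom _) v).
exact/mghomP.
Qed.

(* The module M^* computed from a presentation of M. *)
Definition expansion (M : mgmod K n) (p : presentation M) :
    mgdata K (\sum_(j < n) i_ j) :=
  coker (expfree_hom (pres_phi p)).

(* The map alpha^* computed from a lifting of alpha. *)
Definition expansion_hom (M N : mgmod K n) (p : presentation M)
    (q : presentation N) (alpha : mghom M N) (l : lifting p q alpha) :
    mghom (expansion p) (expansion q) :=
  coker_hom (u0 := expfree_hom (lift0 l)) (u1 := expfree_hom (lift1 l))
    (expfree_hom_square (lift_phi l)).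

End Expansion.

Section Functors.
Variables (K : fieldType) (n m : nat).
Variable T0 : mgmod K n -> mgmod K m.
Variable T : forall M N : mgmod K n, mghom M N -> mghom (T0 M) (T0 N).

Definition is_functor : Prop :=
  (forall M : mgmod K n, T (mgid M : mghom M M) = mgid (T0 M)) /\
  (forall (M N P : mgmod K n) (g : mghom N P) (f : mghom M N),
    T (mgcomp_hom g f : mghom M P) = mgcomp_hom (T g) (T f)).

Definition is_additive : Prop :=
  forall (M N : mgmod K n) (f g : mghom M N), T (mgadd f g) = mgadd (T f) (T g).

Definition is_exact : Prop :=
  forall (M N P : mgmod K n) (f : mghom M N) (g : mghom N P),
    short_exact f g -> short_exact (T f) (T g).

End Functors.

(* Main.v *)
Require Import Defs.
From HB Require Import structures.
From mathcomp Require Import all_boot all_order all_algebra.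
From mathcomp Require Import boolp mpoly.

Set Implicit Arguments.
Unset Strict Implicit.
Unset Printing Implicit Defensive.

Import GRing.Theory.
Local Open Scope ring_scope.

(* For an exponent vector c of S^*, let b(c) in N^n record the total degree of c
   in each block of variables.  A monomial x^c lies in (x^a)^* iff a <= b(c), so
   the degree-c part of S(-a)^* is canonically the degree-b(c) part of S(-a).
   Passing to cokernels, the degree-c part of M^* is canonically the degree-b(c)
   part of M, naturally in M and for any choice of liftings.  Functoriality,
   additivity and exactness of M |-> M^* can therefore be read off degree by
   degree: [fiber c] is the projection M^* -> M_b(c). *)

(** * Products and powers of ideals *)

Section IdealProducts.
Variable R : comNzRingType.
Implicit Types I J D : R -> Prop.

Lemma ideal_gen_mem (A : R -> Prop) x : A x -> ideal_gen A x.
Proof.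
by move=> Ax; exists 1%N, (fun=> 1), (fun=> x); rewrite big_ord1 mul1r.
Qed.

Lemma idealM_mul I J x y : I x -> J y -> idealM I J (x * y).
Proof. by move=> Ix Jy; apply: ideal_gen_mem; exists x, y. Qed.

Lemma ideal_gen_min (A : R -> Prop) D : is_ideal D ->
  (forall x, A x -> D x) -> forall x, ideal_gen A x -> D x.
Proof.
by move=> Did AD _ [r [c [g [Ag ->]]]]; apply: ideal_sum => // k; exact/AD.
Qed.

Lemma idealM_min I J D : is_ideal D ->
  (forall x y, I x -> J y -> D (x * y)) -> forall z, idealM I J z -> D z.
Proof.
by move=> Did h; apply: ideal_gen_min => // _ [x [y [Ix Jy ->]]]; exact: h.
Qed.

Lemma idealM_subl I J : is_ideal I -> forall x, idealM I J x -> I x.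
Proof.
move=> Iid; apply: idealM_min => // x y Ix _.
by case: Iid => I0 IP; rewrite mulrC -[_ * _]addr0; exact: IP.
Qed.

Lemma idealX_mul I k l x y :
  idealX I k x -> idealX I l y -> idealX I (k + l) (x * y).
Proof.
move=> + Iy; elim: k x => [|k IH] x Ix.
  by case: (idealX_ideal I l) => I0 IP; rewrite -[_ * _]addr0; exact: IP.
have [I0 IP] := idealX_ideal I (k.+1 + l).
apply: (idealM_min (D := fun x => idealX I (k.+1 + l) (x * y))) Ix.
  split; first by rewrite mul0r.
  by move=> c u v hu hv; rewrite mulrDl -mulrA; exact: IP.
by move=> u v Iu Iv; rewrite -mulrA; apply: idealM_mul => //; exact: IH.
Qed.

Lemma idealX_exp I x k : I x -> idealX I k (x ^+ k).
Proof.
by move=> Ix; elim: k => [//|k IH]; rewrite exprS; exact: idealM_mul.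
Qed.

Lemma idealM_big_sub (T : eqType) (s : seq T) (F : T -> R -> Prop) i x :
  (forall j, is_ideal (F j)) -> i \in s ->
  (\big[@idealM R/@ideal_full R]_(j <- s) F j) x -> F i x.
Proof.
move=> Fid; elim: s x => [//|j s IH] x; rewrite inE big_cons.
case/predU1P => [->|si]; first exact: idealM_subl.
move=> h; apply: IH => //; apply: idealM_subr h.
by apply: big_rec => // k I _ _; exact: ideal_gen_ideal.
Qed.

End IdealProducts.

(** * Spans and finite generation *)

Section Spanning.
Variables (R : comNzRingType) (V : lmodType R).

Definition submodule (P : V -> Prop) :=
  P 0 /\ forall c x y, P x -> P y -> P (c *: x + y).

(** Phrased through all submodules containing [s], so that finite generation of a product can be
    proved by choosing a suitable submodule; [spannedP] recovers explicit coefficients. *)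
Definition spanned (s : seq V) (x : V) :=
  forall P, submodule P -> (forall g, g \in s -> P g) -> P x.

Lemma spannedP s x : spanned s x ->
  exists c : 'I_(size s) -> R, x = \sum_(k < size s) c k *: s`_k.
Proof.
move=> xs; apply: (xs (fun x => exists c : 'I_(size s) -> R,
  x = \sum_(k < size s) c k *: s`_k)); first split.
- by exists (fun=> 0); rewrite big1 // => k _; rewrite scale0r.
- move=> a _ _ [c ->] [d ->]; exists (fun k => a * c k + d k).
  rewrite scaler_sumr -big_split; apply: eq_bigr => k _ /=.
  by rewrite scalerDl scalerA.
- move=> g gs; pose k0 := Ordinal (etrans (index_mem g s) gs).
  exists (fun k => (k == k0)%:R); rewrite (bigD1 k0) //= eqxx scale1r.
  by rewrite nth_index // big1 ?addr0 // => k /negbTE ->; rewrite scale0r.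
Qed.

Lemma submodule_sum (P : V -> Prop) (T : Type) (s : seq T) (F : T -> V) :
  submodule P -> (forall i, P (F i)) -> P (\sum_(i <- s) F i).
Proof.
case=> P0 PP PF; elim/big_ind: _ => // x y Px Py.
by rewrite -[x]scale1r; exact: PP.
Qed.

Definition fg_subset (I : V -> Prop) :=
  exists s, (forall g, g \in s -> I g) /\ forall x, I x -> spanned s x.

End Spanning.

Lemma fg_ideal_gen_fin (R : comNzRingType) (A : R -> Prop) (s : seq R) :
  (forall x, A x <-> x \in s) -> fg_subset (ideal_gen A : R^o -> Prop).
Proof.
move=> As; exists s; split; first by move=> g /As; exact: ideal_gen_mem.
move=> x Ix P Pid Ps; apply: (ideal_gen_min _ _ Ix); first exact: Pid.
by move=> y /As; exact: Ps.
Qed.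

(** The pairwise products of generators suffice: for fixed [y], the [x] with [P (x * y)] form a
    submodule, which reduces [x] to a generator; then the same is done for [y]. *)
Lemma fg_idealM (R : comNzRingType) (I J : R -> Prop) :
  fg_subset (I : R^o -> Prop) -> fg_subset (J : R^o -> Prop) ->
  fg_subset (idealM I J : R^o -> Prop).
Proof.
move=> [s [sI Is]] [t [tJ Jt]]; exists [seq x * y | x <- s, y <- t]; split.
  move=> _ /allpairsP[[x y] [xs yt ->]].
  by apply: idealM_mul; [exact: sI|exact: tJ].
move=> z Iz P Pid Pst; apply: (idealM_min _ _ Iz); first exact: Pid.
case: Pid => P0 PP x y /Is Ix /Jt Jy.
apply: (Ix (fun x => P (x * y))).
  split=> [|c u v Pu Pv]; first by rewrite mul0r.
  by rewrite mulrDl -mulrA; exact: PP.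
move=> g gs; apply: (Jy (fun y => P (g * y))).
  split=> [|c u v Pu Pv]; first by rewrite mulr0.
  by rewrite mulrDr mulrCA; exact: PP.
by move=> h ht; apply: Pst; exact: allpairs_f.
Qed.

Lemma fg_ideal_full (R : comNzRingType) : fg_subset (@ideal_full R : R^o -> Prop).
Proof.
exists [:: 1]; split=> // x _ P [P0 PP] P1.
by rewrite -[x]addr0 -[x]mulr1; apply: PP => //; exact/P1/mem_head.
Qed.

(** * The ideals (x^a)^* as monomial ideals *)

Section ExpandedIdeals.
Variables (K : fieldType) (n : nat) (i_ : 'I_n -> nat).
Local Notation N := (\sum_(j < n) i_ j)%N.
Local Notation Sx := {mpoly K[N]}.

Lemma fg_expX (a : 'X_{1..n}) : fg_subset (@expX K n i_ a : Sx^o -> Prop).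
Proof.
apply: (big_ind (fun I : Sx -> Prop => fg_subset (I : Sx^o -> Prop))).
- exact: fg_ideal_full.
- by move=> I J; exact: fg_idealM.
move=> j _; elim: (a j) => [|k IH]; first exact: fg_ideal_full.
apply: fg_idealM IH; apply: (@fg_ideal_gen_fin _ _
  [seq 'X_(tagnat.Rank j k) | k <- enum 'I_(i_ j)]) => x.
split=> [[l ->]|/mapP[l _ ->]]; last by exists l.
by apply/mapP; exists l; rewrite ?mem_enum.
Qed.

Definition blockdeg (c : 'X_{1..N}) : 'X_{1..n} :=
  [multinom (\sum_(k < i_ j) c (tagnat.Rank j k))%N | j < n].

Lemma blockdegD c d : blockdeg (c + d) = (blockdeg c + blockdeg d)%MM.
Proof.
apply/mnmP => j; rewrite mnmDE !mnmE -big_split /=.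
by apply: eq_bigr => k _; rewrite mnmDE.
Qed.

Lemma expX_blockdeg (a : 'X_{1..n}) (x : Sx) : expX a x ->
  forall c, c \in msupp x -> (a <= blockdeg c)%MM.
Proof.
move=> ax c cx; apply/mnm_lepP => j; move: c cx.
(* A product of ideals lies in each factor, so coordinate [j] of the bound only requires the factor
   P_j^a(j). *)
have {ax} : idealX (@expP K n i_ j) (a j) x.
  by apply: (idealM_big_sub _ _ ax) => [k|]; [exact: idealX_ideal|exact: mem_index_enum].
(* The [D k] form a multiplicative filtration by ideals whose first step contains P_j, hence [D k]
   contains P_j^k. *)
pose D k (x : Sx) := forall c, c \in msupp x -> (k <= blockdeg c j)%N.
have DM k l y z : D k y -> D l z -> D (k + l)%N (y * z).
  move=> Dy Dz c /msuppM_le /allpairsP[[d e] /= [/Dy dk /Dz el ->]].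
  by rewrite blockdegD mnmDE leq_add.
have Did k : is_ideal (D k).
  split=> [c|c y z Dy Dz d /msuppD_le]; first by rewrite msupp0.
  rewrite mem_cat => /orP[|/Dz//]; exact: (DM 0%N k).
rewrite -/(D (a j) x); elim: (a j) x => [//|k IH] x.
apply: idealM_min => // y z Py /IH; apply: (DM 1%N); move: y Py.
apply: ideal_gen_min => // _ [l ->] c.
rewrite msuppX inE => /eqP ->; rewrite mnmE (bigD1 l) //= mnm1E eqxx //.
Qed.

(** The monomial splits into its blocks; the part in block [j] is a product of [blockdeg c j]
    generators of P_j, and this number is at least [a j]. *)
Lemma expX_mpolyX (a : 'X_{1..n}) c :
  (a <= blockdeg c)%MM -> @expX K n i_ a 'X_[c].
Proof.
move=> /mnm_lepP ac.
have -> : 'X_[c] = \prod_(j < n) \prod_(k < i_ j)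
    'X_(tagnat.Rank j k) ^+ c (tagnat.Rank j k) :> Sx.
  rewrite mpolyXE_id (reindex (@tagnat.rank n i_)) /=; last first.
    by exists tagnat.sig => ? _; rewrite ?tagnat.rankK ?tagnat.sigK.
  by rewrite (sig_big_dep xpredT (fun=> xpredT)
    (fun j k => 'X_(tagnat.Rank j k) ^+ c (tagnat.Rank j k))); apply: eq_bigr => -[j k] _.
apply: (big_ind2 (fun (x : Sx) (I : Sx -> Prop) => I x)) => //.
  by move=> x I y J; exact: idealM_mul.
move=> j _; apply: (idealX_antitone (ac j)); rewrite mnmE.
apply: (big_ind2 (fun (x : Sx) d => idealX (@expP K n i_ j) d x)) => //.
  by move=> x k y l; exact: idealX_mul.
move=> k _.
by apply: idealX_exp; apply: ideal_gen_mem; exists k.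
Qed.

Lemma expXP (a : 'X_{1..n}) (x : Sx) :
  expX a x <-> forall c, c \in msupp x -> (a <= blockdeg c)%MM.
Proof.
split=> [|ax]; first exact: expX_blockdeg.
have [I0 IP] := @expX_ideal K n i_ a; rewrite [x]mpolyE big_seq.
elim/big_ind: _ => // [y z Iy Iz|c /ax ac].
  by rewrite -[y]mul1r; exact: IP.
by rewrite -mul_mpolyC -[_ * _]addr0; apply: IP => //; exact: expX_mpolyX.
Qed.

End ExpandedIdeals.

Lemma sum_uniq_eq (T : eqType) (V : nmodType) (s : seq T) (F : T -> V) x :
  uniq s -> \sum_(y <- s) (if y == x then F y else 0) = if x \in s then F x else 0.
Proof.
move=> us; case: ifPn => xs.
  by rewrite (bigD1_seq x) //= eqxx big1 ?addr0 // => y /negbTE ->.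
rewrite big_seq big1 // => y ys; case: eqP => // e.
by rewrite -e ys in xs.
Qed.

(** * Homogeneous preimages under graded maps *)

Section Multigraded.
Variables (K : fieldType) (n : nat).

Definition mg_subgroups (M : mgdata K n) := forall a,
  mgcomp a (0 : M) /\
  (forall x y : M, mgcomp a x -> mgcomp a y -> mgcomp a (x - y)).

Definition mg_spanned (M : mgdata K n) := forall x : M,
  exists (s : seq 'X_{1..n}) (h : 'X_{1..n} -> M),
    (forall a, mgcomp a (h a)) /\ x = \sum_(a <- s) h a.

Lemma mgcomp0 (M : mgmod K n) a : mgcomp a (0 : M).
Proof. by have [/(_ a)[]] := mgmod_graded M. Qed.

Lemma mgcompB (M : mgmod K n) a (x y : M) :
  mgcomp a x -> mgcomp a y -> mgcomp a (x - y).
Proof. by have [/(_ a)[_ h] _ _ _] := mgmod_graded M; exact: h. Qed.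

Lemma mgcompMn (M : mgdata K n) a (x : M) k :
  mg_subgroups M ->
  mgcomp a x -> mgcomp a (x *+ k).
Proof.
move=> /(_ a)[M0 MB] ax; elim: k => [//|k IH].
by rewrite mulrSr -[x in _ + x]opprK; apply: (MB) => //; rewrite -sub0r; exact: MB.
Qed.

(* Uniqueness of homogeneous components is needed in the target only, so this
   applies to free sources without showing that they are graded. *)
Lemma mghom_lift (M : mgdata K n) (N : mgmod K n) (f : mghom M N) a x :
  mg_subgroups M -> mg_spanned M ->
  mgcomp a (f x) -> exists2 x', mgcomp a x' & f x' = f x.
Proof.
move=> MB Mdec ax; have [s [h [hh ex]]] := Mdec x.
(* Degrees may repeat in [s], so copies are collected; [h' a] is 0 when [a] does not occur. *)
pose h' b := h b *+ count_mem b s.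
have hh' b : mgcomp b (h' b) by apply: mgcompMn.
have {}ex : x = \sum_(b <- undup (a :: s)) h' b.
  rewrite ex -(big_undup_iterop_count _ s xpredT h) /=.
  case: ifP => [_|/negbT/count_memPn as0]; first exact: eq_bigr.
  by rewrite big_cons {1}/h' as0 mulr0n add0r; exact: eq_bigr.
exists (h' a) => //.
(* Difference of two homogeneous decompositions of [f x]: the image of that of [x], and the one
   concentrated in degree [a]. It sums to 0, so each term vanishes. *)
pose k b : N := f (h' b) - (if b == a then f x else 0).
have hk b : mgcomp b (k b).
  apply: mgcompB; first exact: mghom_graded.
  by case: eqP => [->|_] //; exact: mgcomp0.
have [_ _ _ uniqN] := mgmod_graded N.
have ain : a \in undup (a :: s) by rewrite mem_undup mem_head.
apply/eqP; rewrite -subr_eq0; apply/eqP.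
suff : k a = 0 by rewrite /k eqxx.
apply: (uniqN (undup (a :: s))) => //; first exact: undup_uniq.
rewrite sumrB -linear_sum -ex (bigD1_seq a) ?undup_uniq //= eqxx.
by rewrite big1 ?addr0 ?subrr // => b /negbTE ->.
Qed.

End Multigraded.

(** * Homogeneous decomposition in free modules *)

Section Free.
Variables (K : fieldType) (n : nat) (r : nat) (a : 'I_r -> 'X_{1..n}).
Local Notation S := {mpoly K[n]}.

Lemma freemod_subgroups : mg_subgroups (freemod K a).
Proof.
move=> c; split=> [i m|x y hx hy i m]; rewrite !mxE ?msupp0 // => /msuppB_le.
by rewrite mem_cat => /orP[/hx|/hy].
Qed.

Lemma freemod_spanned : mg_spanned (freemod K a).
Proof.
move=> x; pose x' : 'rV[S]_r := x.
(* In degree [c], coordinate [i] can only carry the monomial of exponent [c - a i]. *)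
pose h c : 'rV[S]_r := \row_i
  if (a i <= c)%MM then (x' 0 i)@_(c - a i) *: 'X_[c - a i] else 0.
exists (undup (flatten [seq [seq (m + a i)%MM | m <- msupp (x' 0 i)] | i : 'I_r])), h.
split=> [c i m|].
  rewrite mxE; case: ifP => [ac|_]; last by rewrite msupp0.
  by move=> /msuppZ_le; rewrite msuppX inE => /eqP ->; rewrite submK.
apply/rowP => i; rewrite summxE -/x'; apply/mpolyP => m; rewrite raddf_sum /=.
have hE c : (h c 0 i)@_m = if c == (m + a i)%MM then (x' 0 i)@_m else 0.
  rewrite mxE; case: ifP => [ac|/negP nac].
    rewrite mcoeffZ mcoeffX; have [->|ne] := eqVneq c (m + a i)%MM.
      by rewrite addmK eqxx mulr1.
    case: eqP => [e|]; last by rewrite mulr0.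
    by rewrite -e submK ?eqxx in ne.
  rewrite mcoeff0; case: eqP => [e|//]; case: nac.
  by rewrite e lem_addl.
rewrite (eq_bigr _ (fun c _ => hE c)) sum_uniq_eq ?undup_uniq //.
case: ifPn => // mx; apply: memN_msupp_eq0; apply: contra mx => mx.
rewrite mem_undup; apply/flattenP.
by exists [seq (m + a i)%MM | m <- msupp (x' 0 i)]; [exact: image_f|exact: map_f].
Qed.

End Free.

(** * Comparison of F^* with F, degree by degree *)

Section ExpandedFree.
Variables (K : fieldType) (n : nat) (i_ : 'I_n -> nat).
Local Notation N := (\sum_(j < n) i_ j)%N.
Local Notation S := {mpoly K[n]}.
Local Notation Sx := {mpoly K[N]}.
Local Notation blockdeg := (@blockdeg n i_).
Implicit Types c d : 'X_{1..N}.

Lemma expfree_valE r (a : 'I_r -> 'X_{1..n}) (v : expfree K i_ a) i c :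
  ((expfree_val v) 0 i)@_c != 0 -> (a i <= blockdeg c)%MM.
Proof.
rewrite -mcoeff_msupp; case: v => v /= /asboolP /(_ i) hv; exact: expX_blockdeg.
Qed.

Lemma expfree_subgroups r (a : 'I_r -> 'X_{1..n}) : mg_subgroups (expfree K i_ a).
Proof.
move=> c; split=> [i m|x y hx hy i m]; rewrite /= !mxE ?msupp0 // => /msuppB_le.
by rewrite mem_cat => /orP[/hx|/hy].
Qed.

Section Graded.
Variables (r : nat) (a : 'I_r -> 'X_{1..n}).
Local Notation F := (freemod K a).
Local Notation Fx := (expfree K i_ a).

(* The degree-c part of F^*, carried over to the degree-(blockdeg c) part of F. *)
Definition contract c (v : Fx) : F :=
  (\row_i (((expfree_val v) 0 i)@_c *: 'X_[blockdeg c - a i]) : 'rV[S]_r).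

Lemma contractB c : zmod_morphism (contract c).
Proof. by move=> u v; apply/rowP => i; rewrite !mxE mcoeffB scalerBl. Qed.
HB.instance Definition _ c := GRing.isZmodMorphism.Build Fx F (contract c) (contractB c).

(** Subtraction of exponents is truncated, but where [a i] is not below [blockdeg c] the coefficient
    of x^c in coordinate [i] is 0 by [expfree_valE]. *)
Lemma contract_graded c v : mgcomp (blockdeg c) (contract c v).
Proof.
move=> i m; rewrite mxE.
have [-> |nz] := eqVneq (((expfree_val v) 0 i)@_c) 0; first by rewrite scale0r msupp0.
by move=> /msuppZ_le; rewrite msuppX inE => /eqP ->; rewrite submK //; exact: expfree_valE nz.
Qed.

(** Inverse to [contract c] on homogeneous elements. The guard keeps x^c inside the ideal of
    coordinate [i]. *)
Definition expand_row c (w : 'rV[S]_r) : 'rV[Sx]_r := \row_i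
  if (a i <= blockdeg c)%MM then (w 0 i)@_(blockdeg c - a i) *: 'X_[c] else 0.

Lemma expand_rowP c w : expand_row c w \in expfree_pred a.
Proof.
apply/asboolP => i; apply/expXP => d; rewrite mxE; case: ifP => [ac|_].
  by move=> /msuppZ_le; rewrite msuppX inE => /eqP ->.
by rewrite msupp0.
Qed.

Definition expand c (w : F) : Fx := ExpFree (expand_rowP c w).

Lemma expand_graded c w : mgcomp c (expand c w).
Proof.
move=> i m; rewrite /= mxE; case: ifP => [_|_]; last by rewrite msupp0.
by move=> /msuppZ_le; rewrite msuppX inE => /eqP.
Qed.

Lemma contract_homog c d v : mgcomp c v -> d != c -> contract d v = 0.
Proof.
move=> cv /eqP ne; apply/rowP => i; rewrite !mxE memN_msupp_eq0 ?scale0r //.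
by apply/negP => /cv.
Qed.

Lemma expandK c w : mgcomp (blockdeg c) w -> contract c (expand c w) = w.
Proof.
move=> hw; apply/rowP => i; rewrite !mxE.
have hwi m : m \in msupp (w 0 i : S) -> (m + a i)%MM = blockdeg c by apply: hw.
case: ifP => [ac|/negP nac].
  rewrite mcoeffZ mcoeffX eqxx mulr1; apply/mpolyP => m.
  rewrite mcoeffZ mcoeffX; case: eqP => [->|ne]; first by rewrite mulr1.
  rewrite mulr0 memN_msupp_eq0 //; apply/negP => /hwi e.
  by apply: ne; rewrite -e addmK.
rewrite mcoeff0 scale0r; apply/esym/msuppnil0.
case e: (msupp _) => [//|m s]; case: nac; rewrite -(hwi m) ?lem_addl //.
by rewrite e mem_head.
Qed.

(** Contracting and expanding again is the projection of F^* onto its degree-[c] part. *)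
Lemma contractK c v i d :
  ((expfree_val (expand c (contract c v))) 0 i)@_d
    = if c == d then ((expfree_val v) 0 i)@_d else 0.
Proof.
rewrite /= mxE; case: ifP => [ac|nac].
  rewrite !mcoeffZ mxE !mcoeffX mcoeffZ mcoeffX eqxx mulr1.
  by case: eqP => [->|]; rewrite ?mulr1 ?mulr0.
rewrite mcoeff0; case: eqP => // <-; apply/esym/eqP/negPn/negP => /expfree_valE.
by rewrite nac.
Qed.

Lemma expfree_decomp v :
  exists2 s, uniq s & v = \sum_(c <- s) expand c (contract c v).
Proof.
pose s := undup (flatten [seq msupp ((expfree_val v) 0 i) | i : 'I_r]).
exists s; first exact: undup_uniq.
apply/val_inj/rowP => i; apply/mpolyP => d.
have -> : val (\sum_(c <- s) expand c (contract c v)) =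
    \sum_(c <- s) val (expand c (contract c v)) by rewrite raddf_sum.
rewrite summxE raddf_sum /= (eq_bigr _ (fun c _ => contractK c v i d)).
rewrite (sum_uniq_eq (fun c => (expfree_val v 0 i)@_d)) ?undup_uniq //.
case: ifPn => // dx; apply: memN_msupp_eq0; apply: contra dx => dx.
rewrite mem_undup; apply/flattenP.
by exists (msupp ((expfree_val v) 0 i)); first exact: image_f.
Qed.

End Graded.

Section Natural.
Variables (r s : nat) (a : 'I_r -> 'X_{1..n}) (b : 'I_s -> 'X_{1..n}).
Variable alpha : mghom (freemod K a) (freemod K b).

Lemma hom_coef_neq0 j i : hom_coef alpha j i != 0 -> (b j <= a i)%MM.
Proof. by rewrite /hom_coef; case: ifP => //; rewrite eqxx. Qed.

Lemma mnm_subD (x y z : 'X_{1..n}) :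
  (x <= y)%MM -> (y <= z)%MM -> (z - x = (z - y) + (y - x))%MM.
Proof. by move=> xy yz; apply: (@addIm _ x); rewrite -addmA !submK ?(lepm_trans xy yz). Qed.

(** Both maps have the same scalars lambda_ji, and the monomial of exponent [a i - b j] is exactly
    what turns exponent [blockdeg c - a i] into [blockdeg c - b j]. *)
Lemma contract_hom c v :
  contract c (expfree_hom i_ alpha v) = alpha (contract c v).
Proof.
apply/rowP => j; rewrite mxE hom_freeE /= mxE raddf_sum scaler_suml.
apply: eq_bigr => i _; rewrite mxE /= mcoeffZ.
have [->|nz1] := eqVneq (hom_coef alpha j i) 0; first by rewrite mul0r !scale0r mulr0.
have [->|nz2] := eqVneq ((expfree_val v 0 i)@_c) 0; first by rewrite mulr0 !scale0r mul0r.
rewrite (mnm_subD (hom_coef_neq0 nz1) (expfree_valE nz2)) mpolyXD.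
by rewrite -scalerAl -scalerAr scalerA mulrC.
Qed.

Lemma expand_hom c w :
  expand c (alpha w) = expfree_hom i_ alpha (expand c w).
Proof.
apply/val_inj/rowP => j; rewrite /= !mxE hom_freeE raddf_sum /=.
have [bc|nbc] := boolP (b j <= blockdeg c)%MM; last first.
  (* A nonzero term would give [b j <= a i <= blockdeg c]. *)
  apply/esym/big1 => i _; rewrite mxE.
  have [->|nz] := eqVneq (hom_coef alpha j i) 0; first by rewrite scale0r.
  case: ifP => [ac|_]; last by rewrite scaler0.
  by rewrite (lepm_trans (hom_coef_neq0 nz) ac) in nbc.
rewrite scaler_suml; apply: eq_bigr => i _; rewrite mxE -scalerAr mcoeffZ.
have [->|nz] := eqVneq (hom_coef alpha j i) 0; first by rewrite mul0r !scale0r.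
have ba := hom_coef_neq0 nz.
case: ifP => [ac|nac]; first by rewrite (mnm_subD ba ac) addmC mcoeffMX scalerA.
(* If the exponent [blockdeg c - b j] occurred in a multiple of the monomial of exponent
   [a i - b j], adding [b j] would give [a i <= blockdeg c]. *)
rewrite scaler0 memN_msupp_eq0 ?mulr0 ?scale0r // (perm_mem (msuppMX _ _)).
apply/negP => /mapP[m _ e]; move: nac.
rewrite -(submK bc) e -addmA [(m + _)%MM]addmC addmA submK //.
by rewrite lem_addr.
Qed.

End Natural.
End ExpandedFree.
Arguments expand_graded {K n i_ r a} c w.

(** * Comparison of M^* with M, degree by degree *)

Section Fibers.
Variables (K : fieldType) (n : nat) (i_ : 'I_n -> nat).
Local Notation N := (\sum_(j < n) i_ j)%N.
Local Notation S := {mpoly K[n]}.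
Local Notation Sx := {mpoly K[N]}.
Local Notation blockdeg := (@blockdeg n i_).
Implicit Types c d : 'X_{1..N}.

Lemma expfree_fg r (a : 'I_r -> 'X_{1..n}) :
  exists s : seq (expfree K i_ a), forall v, spanned s v.
Proof.
have [s hs] := choice (fun i => @fg_expX K n i_ (a i)).
(* Inclusion of the [i]-th summand; the default 0 is taken only for [x] outside the ideal. *)
pose e i (x : Sx) : expfree K i_ a := insubd 0 (x *: delta_mx 0 i : 'rV[Sx]_r).
have eP i x : expX (a i) x -> val (e i x) = x *: delta_mx 0 i.
  move=> ax; apply: insubdK; apply/asboolP => j; rewrite !mxE eqxx /=.
  case: eqP => [->|_]; first by rewrite mulr1.
  by rewrite mulr0; case: (@expX_ideal K n i_ (a j)).
exists [seq e i x | i <- enum 'I_r, x <- s i] => v P Psub Ps.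
have -> : v = \sum_i e i ((expfree_val v) 0 i).
  apply/val_inj; rewrite raddf_sum /= [LHS]row_sum_delta; apply: eq_bigr => i _.
  by rewrite eP //; case: (v) => v' /= /asboolP.
apply: submodule_sum => // i.
have [/asboolP/(_ i) vi] := expfree_valP v; have [sI Is] := hs i.
(* Membership is carried along because [e i] is known to be linear only on the ideal. *)
pose Q (x : Sx^o) := expX (a i) x /\ P (e i x).
suff [] : Q ((expfree_val v) 0 i) by [].
apply: (Is _ vi) => [|g gs]; last first.
  by split; [exact: sI | apply: Ps; apply: allpairs_f_dep; rewrite ?mem_enum].
have [I0 IP] := @expX_ideal K n i_ (a i); have [P0 PP] := Psub; split.
  split=> //; suff -> : e i 0 = 0 by [].
  by apply/val_inj; rewrite eP // scale0r.
move=> c x y [ax Px] [ay Py]; split; first exact: IP.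
suff -> : e i (c *: x + y) = c *: e i x + e i y by exact: PP.
apply/val_inj; rewrite eP; last exact: IP.
by rewrite [RHS]/= !eP // scalerDl scalerA.
Qed.

Section Object.
Variables (M : mgmod K n) (p : presentation M).
Local Notation Mx := (expansion i_ p).

Definition fiber c (q : Mx) : M := pres_eps p (contract c (lq_repr q)).

Lemma pres_eps_phi v : pres_eps p (pres_phi p v) = 0.
Proof. by apply/pres_exact; exists v. Qed.

(** Independence of the representative: two of them differ by an element of the image of phi^*,
    which [contract_hom] sends into the image of phi, killed by [pres_eps]. *)
Lemma fiberE c v :
  fiber c (coker_pi (expfree_hom i_ (pres_phi p)) v) = pres_eps p (contract c v).
Proof.
set f := expfree_hom _ _.
have /coker_piP[z ez] : coker_pi f (lq_repr (coker_pi f v)) = coker_pi f v.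
  by rewrite /= lq_reprK.
apply/eqP; rewrite -subr_eq0 /fiber -!raddfB ez /= (contract_hom (pres_phi p)).
by rewrite pres_eps_phi.
Qed.

Lemma fiberB c : zmod_morphism (fiber c).
Proof.
move=> q q'; have [u ->] := coker_pi_surj q; have [v ->] := coker_pi_surj q'.
by rewrite -raddfB !fiberE !raddfB.
Qed.
HB.instance Definition _ c := GRing.isZmodMorphism.Build Mx M (fiber c) (fiberB c).

Lemma fiber_graded c q : mgcomp (blockdeg c) (fiber c q).
Proof. by apply: mghom_graded; exact: contract_graded. Qed.

Lemma fiber_homog c d q : mgcomp c q -> d != c -> fiber d q = 0.
Proof.
move=> [v cv ->] ne; rewrite -[lq_pi _ v]/(coker_pi _ v) fiberE.
by rewrite (contract_homog cv) ?raddf0.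
Qed.

(** Each contraction of a representative lies in the image of phi by exactness of the presentation;
    [expand_hom] moves this back to F^*, so every homogeneous part of the representative lies in the
    image of phi^*. *)
Lemma fiber_eq0 q : (forall c, fiber c q = 0) -> q = 0.
Proof.
have [v ->] := coker_pi_surj q => hv.
have [s _ ->] := expfree_decomp v; rewrite raddf_sum; apply: big1 => c _.
have /pres_exact[w ->] : pres_eps p (contract c v) = 0 by rewrite -fiberE.
rewrite -(raddf0 (coker_pi _)); apply/coker_piP.
by exists (expand c w); rewrite subr0 expand_hom.
Qed.

Lemma fiber_inj q q' : (forall c, fiber c q = fiber c q') -> q = q'.
Proof.
move=> e; apply/eqP; rewrite -subr_eq0; apply/eqP/fiber_eq0 => c.
by rewrite raddfB /= e subrr.
Qed.

(** A homogeneous preimage of [y] in the free module is expanded in degree [c]. With [fiber_eq0]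
    this identifies the degree-[c] part of M^* with the degree-[blockdeg c] part of M. *)
Lemma fiber_onto c y : mgcomp (blockdeg c) y ->
  exists q, forall d, fiber d q = if d == c then y else 0.
Proof.
have [w ->] := pres_surj p y => /(mghom_lift (@freemod_subgroups _ _ _ _)).
case=> [|w' hw' <-]; first exact: freemod_spanned.
exists (coker_pi _ (expand c w')) => d; rewrite fiberE.
have [->|ne] := eqVneq d c; first by rewrite expandK.
by rewrite (contract_homog (expand_graded c w')) ?raddf0.
Qed.

Lemma fiber_supp q :
  exists2 s, uniq s & forall c, c \notin s -> fiber c q = 0.
Proof.
have [v ->] := coker_pi_surj q; have [s us ev] := expfree_decomp v.
exists s => // c cs; rewrite fiberE ev !raddf_sum big_seq; apply: big1 => d ds /=.
rewrite (contract_homog (expand_graded d _)) ?raddf0 //.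
by apply: contraNneq cs => ->.
Qed.

Lemma fiber_section (s : seq 'X_{1..N}) (y : 'X_{1..N} -> M) : uniq s ->
  (forall c, mgcomp (blockdeg c) (y c)) ->
  exists q, forall c, fiber c q = if c \in s then y c else 0.
Proof.
move=> us hy; have [q hq] := choice (fun c => fiber_onto (hy c)).
exists (\sum_(c <- s) q c) => d; rewrite raddf_sum /=.
rewrite -(sum_uniq_eq y) //; apply: eq_bigr => c _.
by rewrite hq eq_sym.
Qed.

Lemma expansion_fg : finitely_generated Mx.
Proof.
have [s hs] := expfree_fg (@pres_a0 _ _ _ p).
exists (size s), (fun k => coker_pi _ s`_k) => q.
have [v ->] := coker_pi_surj q; have [c ->] := spannedP (hs v).
by exists c; rewrite linear_sum; apply: eq_bigr => k _; rewrite linearZ.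
Qed.

Lemma expansion_multigraded : multigraded Mx.
Proof.
split.
- move=> c; have [F0 FB] := @expfree_subgroups K n i_ _ (@pres_a0 _ _ _ p) c.
  split; first by exists 0; rewrite ?raddf0.
  by move=> _ _ [x cx ->] [y cy ->]; exists (x - y); rewrite ?raddfB //; exact: FB.
- move=> k b c _ [x cx ->].
  exists ((k *: 'X_[b] : Sx) *: x); last first.
    by rewrite -[RHS]/(coker_pi (expfree_hom i_ (pres_phi p)) _) linearZ.
  move=> i m; rewrite /= mxE => /msuppM_le/allpairsP[[d e] /= [/msuppZ_le]].
  by rewrite msuppX inE => /eqP-> /cx -> ->.
- move=> q; have [v ->] := coker_pi_surj q; have [s _ {1}->] := expfree_decomp v.
  exists s, (fun c => coker_pi _ (expand c (contract c v))); split.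
    by move=> c; apply: mghom_graded; exact: expand_graded.
  by rewrite raddf_sum.
move=> s h us hh h0 c cs; apply: fiber_eq0 => d.
have [->{d}|/(fiber_homog (hh c))//] := eqVneq d c.
(* Taking the fiber at [c] of the relation isolates the term [h c]. *)
have := congr1 (fiber c) h0; rewrite raddf_sum raddf0 (bigD1_seq c) //=.
rewrite [X in _ + X](big1 _ _) ?addr0 // => d ne; apply: fiber_homog (hh d) _.
by rewrite eq_sym.
Qed.

End Object.

(** Naturality of the fibers. The right-hand side does not mention the lifting, whence independence
    of that choice. *)
Lemma fiber_hom (M M' : mgmod K n) (p : presentation M) (p' : presentation M')
    (alpha : mghom M M') (l : lifting p p' alpha) c q :
  fiber c (expansion_hom i_ l q) = alpha (fiber c q).
Proof.
have [v ->] := coker_pi_surj q; rewrite fiberE.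
rewrite [expansion_hom _ _ _](coker_funE (expfree_hom_square (lift_phi l))).
by rewrite fiberE contract_hom lift_eps.
Qed.

Lemma expansion_exact (M1 M2 M3 : mgmod K n) (p1 : presentation M1)
    (p2 : presentation M2) (p3 : presentation M3) (f : mghom M1 M2)
    (g : mghom M2 M3) (lf : lifting p1 p2 f) (lg : lifting p2 p3 g) :
  short_exact f g -> short_exact (expansion_hom i_ lf) (expansion_hom i_ lg).
Proof.
case=> f_inj fg_exact g_surj.
have mgS (M : mgmod K n) : mg_subgroups M by case: (mgmod_graded M).
have mgD (M : mgmod K n) : mg_spanned M by case: (mgmod_graded M).
split.
- move=> q q' e; apply: fiber_inj => c; apply: f_inj.
  by rewrite -!(fiber_hom lf) e.
- move=> y; split=> [gy|[x ->]]; last first.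
    apply: fiber_eq0 => c; rewrite !fiber_hom.
    by apply/fg_exact; exists (fiber c x).
  have [s us hs] := fiber_supp y.
  have hx c : exists x, mgcomp (blockdeg c) x /\ fiber c y = f x.
    have /fg_exact[x ex] : g (fiber c y) = 0 by rewrite -(fiber_hom lg) gy raddf0.
    (* The preimage given by exactness need not be homogeneous; it is replaced by one of degree
       [blockdeg c]. *)
    have := fiber_graded c y; rewrite ex => /(mghom_lift (mgS _) (mgD _)).
    by case=> x' hx' <-; exists x'.
  have [x hx'] := choice hx.
  (* Preimages are glued over the finite set [s] only; outside [s] the fibers of [y] are 0. *)
  have [q hq] := fiber_section p1 us (fun c => (hx' c).1).
  exists q; apply: fiber_inj => c; rewrite fiber_hom hq.
  by case: ifPn => [_|/hs ->]; [exact: (hx' c).2|rewrite raddf0].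
move=> z; have [s us hs] := fiber_supp z.
have hy c : exists y, mgcomp (blockdeg c) y /\ fiber c z = g y.
  have [y ey] := g_surj (fiber c z).
  have := fiber_graded c z; rewrite ey => /(mghom_lift (mgS _) (mgD _)).
  by case=> y' hy' <-; exists y'.
have [y hy'] := choice hy.
have [q hq] := fiber_section p2 us (fun c => (hy' c).1).
exists q; apply: fiber_inj => c; rewrite fiber_hom hq.
by case: ifPn => [_|/hs ->]; [exact: (hy' c).2|rewrite raddf0].
Qed.

End Fibers.

(** * Functoriality, additivity and exactness, read off on fibers *)

Theorem mainTheorem4 (K : fieldType) (n : nat) (i_ : 'I_n -> nat)
    (i_gt0 : forall j : 'I_n, (0 < i_ j)%N)
    (pres : forall M : mgmod K n, presentation M)
    (lift : forall (M N : mgmod K n) (alpha : mghom M N),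
       lifting (pres M) (pres N) alpha) :
  (forall (M N : mgmod K n) (alpha : mghom M N)
     (l l' : lifting (pres M) (pres N) alpha),
     expansion_hom i_ l = expansion_hom i_ l') /\
  exists (star_graded : forall M : mgmod K n, multigraded (expansion i_ (pres M)))
    (star_fg : forall M : mgmod K n, finitely_generated (expansion i_ (pres M))),
    let star0 (M : mgmod K n) : mgmod K (\sum_(j < n) i_ j) :=
      MgMod (star_graded M) (star_fg M) in
    let star (M N : mgmod K n) (alpha : mghom M N) : mghom (star0 M) (star0 N) :=
      expansion_hom i_ (lift M N alpha) in
    [/\ is_functor star, is_additive star & is_exact star].
Proof.
split=> [M N alpha l l'|].
  by apply: mghomP => q; apply: fiber_inj => c; rewrite !fiber_hom.
exists (fun M => expansion_multigraded i_ (pres M)).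
exists (fun M => expansion_fg i_ (pres M)) => star0 star; split; first split.
- by move=> M; apply: mghomP => q; apply: fiber_inj => c; rewrite fiber_hom.
- move=> M N P g f; apply: mghomP => q; apply: fiber_inj => c.
  by rewrite /= !fiber_hom.
- move=> M N f g; apply: mghomP => q; apply: fiber_inj => c.
  by rewrite /= raddfD /= !fiber_hom.
- by move=> M N P f g; exact: expansion_exact.
Qed.
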